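(* Let $k\ge 3$ be an integer and put $s=\binom k2-1$. (a) For every fixed integer $r\ge s$ and every real $\varepsilon>0$, for all sufficiently large $n$, $$\rho_{r,k}(K_n)\ge\left(\binom rs-\varepsilon\right)s^{\binom n2}.$$ (b) For all integers $r\ge 1$ and $n\ge 3$, $$\rho_{r,k}(K_n)\ge r^{1+t_{k-2}(n)}\ge r^{\left(1-\frac1{k-2}\right)\binom n2}.$$
   Context: Write $[r]=\{1,\dots,r\}$. An $r$-coloring of $K_n$ (the complete graph on $n$ labeled vertices) is any function $\varphi:E(K_n)\to[r]$ (not necessarily proper). It is rainbow-$K_k$-free if every copy of $K_k$ in $K_n$ has at least two edges of the same color, and $\rho_{r,k}(K_n)$ denotes the number of rainbow-$K_k$-free $r$-colorings of $K_n$. $t_{p}(n)$ denotes the number of edges of the Turán graph on $n$ vertices with $p$ parts, i.e. the complete $p$-partite graph whose part sizes differ by at most one.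
   Formalization: In (b), the first inequality is claimed only for n ≥ k−1, since for r ≥ 2 and 3 ≤ n ≤ k−2 it fails (K_n has no K_k and t_{k-2}(n) equals C(n,2)); the second inequality and the resulting bound of ρ by the last term are kept for all n ≥ 3. *)

(* Defs.v *)
From mathcomp Require Import all_boot.

Set Implicit Arguments.
Unset Strict Implicit.
Unset Printing Implicit Defensive.

(* The edge set of K_n: the 2-element subsets of the vertex set 'I_n. *)
Definition edge (n : nat) := {e : {set 'I_n} | #|e| == 2}.

(* The colour set {1, ..., r} is represented by 'I_r. *)
Definition coloring (r n : nat) := {ffun edge n -> 'I_r}.

(* A copy of K_k in K_n is given by its k-element vertex set A. *)
Definition rainbow_free (r k n : nat) (phi : coloring r n) : bool :=
  [forall A : {set 'I_n}, (#|A| == k) ==>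
    [exists e : edge n, exists f : edge n,
      [&& e != f, val e \subset A, val f \subset A & phi e == phi f]]].

Definition rho (r k n : nat) : nat :=
  #|[set phi : coloring r n | rainbow_free k phi]|.

(* The p parts are the residue classes mod p; by turan_balanced below their
   sizes differ by at most one. Some parts are empty when n < p. *)
Definition turan_graph (p n : nat) : rel 'I_n :=
  fun x y => x %% p != y %% p.

Definition turan_number (p n : nat) : nat :=
  #|[set e : edge n | [exists x, exists y,
      (val e == [set x; y]) && turan_graph p x y]]|.

Lemma card_residue_class (p n a : nat) : a < p ->
  #|[set x : 'I_n | x %% p == a]| = (n + (p.-1 - a)) %/ p.
Proof.
case: p => // p ltap; have leap : a <= p by [].
rewrite cardsE -sum1_card big_mkcond /=.
rewrite (eq_bigr (fun x : 'I_n => nat_of_bool (x %% p.+1 == a))); last first.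
  by move=> i _; rewrite unfold_in eqnE; case: (_ == a).
elim: n => [|n IHn].
  by rewrite big_ord0 add0n divn_small // ltnS leq_subr.
rewrite big_ord_recr /= IHn addSn divnS // addnC; congr (nat_of_bool _ + _).
rewrite -addnS -subSn // -{1}(modn_small ltap) -(eqn_modDr (p.+1 - a)).
by rewrite subnKC ?modnn // ltnW.
Qed.

Lemma turan_balanced (p n a b : nat) : a < p -> b < p ->
  #|[set x : 'I_n | x %% p == a]| <= #|[set x : 'I_n | x %% p == b]|.+1.
Proof.
move=> ltap ltbp; have p_gt0 : 0 < p by apply: leq_ltn_trans ltap.
have def1 : 1 = p %/ p by rewrite divnn p_gt0.
rewrite !card_residue_class // -addn1 def1 -divnDr //.
apply: leq_div2r; rewrite -addnA leq_add2l.
by rewrite (leq_trans (leq_subr _ _)) // (leq_trans (leq_pred p)) // leq_addl.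
Qed.

(* Main.v *)
Require Import Defs.
From mathcomp Require Import all_boot all_order all_algebra.
From mathcomp Require Import all_reals exp.

(** Both parts count colorings that are visibly rainbow-free.

    Part (a): a copy of K_k has s + 1 edges, so a coloring whose set of used
    colors has size s repeats a color on it ([rainbow_free_few_colors]). Sorting
    such colorings by their set S of colors, and bounding the maps onto S from
    below by s^N - s (s-1)^N with N the number of edges ([card_onto_lower_bound]), gives
    rho + 'C(r, s) s (s-1)^N >= 'C(r, s) s^N ([rho_few_colors]); the correction
    term is negligible against s^N ([geometric_decay]).

    Part (b): color the edges of the Turan graph with p = k - 2 parts freely and
    all edges inside the parts with one common color. Among k vertices spread
    over k - 2 parts there are two distinct edges inside parts, so K_k is never
    rainbow ([rainbow_free_const_inside]); as soon as some edge lies inside a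
    part, the common color can be read off the coloring, and r * r^t colorings
    are obtained ([rho_turan]). For the real exponent, a vertex y has y %/ p
    smaller vertices in its residue class, and p times the sum of these over
    y < n is at most the sum of all y < n, which is 'C(n, 2)
    ([inside_edges_bound]): at most a fraction 1 / p of all edges lies inside
    the parts. If n < k - 1 there is no K_k and every coloring counts. *)

Import Order.TTheory GRing.Theory Num.Theory.

(** * Finite counting *)

Lemma collision (aT rT : finType) (f : aT -> rT) (A : {set aT}) (S : {set rT}) :
  f @: A \subset S -> #|S| < #|A| ->
  exists x y, [/\ x \in A, y \in A, x != y & f x = f y].
Proof.
move=> sub lt.
have /dinjectivePn [x xA [y /andP[/= nyx yA] fxy]] : ~~ dinjectiveb f A.
  apply: contraL lt => /dinjectiveP inj.
  by rewrite -leqNgt -(card_in_imset inj) subset_leq_card.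
by exists x, y; split; rewrite // eq_sym.
Qed.

Lemma sum_card_fibers (T I : finType) (f : T -> I) (A : {set T}) (Q : pred I) :
  \sum_(i | Q i) #|[set x in A | f x == i]| <= #|A|.
Proof.
have -> : \sum_(i | Q i) #|[set x in A | f x == i]| = #|[set x in A | Q (f x)]|.
  rewrite -[RHS]sum1_card (partition_big f Q) /=; last first.
    by move=> x; rewrite inE => /andP[].
  apply: eq_bigr => i Qi; rewrite -sum1_card; apply: eq_bigl => x.
  by rewrite !inE; case: eqP => [->|]; rewrite ?Qi ?andbT ?andbF.
by apply: subset_leq_card; apply/subsetP => x; rewrite inE => /andP[].
Qed.

Lemma card_bigcup_leq (T I : finType) (Q : pred I) (F : I -> {set T}) :
  #|\bigcup_(i | Q i) F i| <= \sum_(i | Q i) #|F i|.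
Proof.
elim/big_rec2: _ => [|i m A _ IH]; first by rewrite cards0.
by apply: leq_trans (leq_card_setU _ _) _; rewrite leq_add2l.
Qed.

(** A map into S that is not onto S misses some c in S, and so takes its values
    in S minus c. *)
Lemma card_onto_lower_bound (aT rT : finType) (S : {set rT}) :
  #|S| ^ #|aT| <=
    #|[set f : {ffun aT -> rT} | f @: setT == S]| + #|S| * #|S|.-1 ^ #|aT|.
Proof.
rewrite -[X in X <= _]card_ffun_on.
pose miss (c : rT) := [set f : {ffun aT -> rT} | f \in ffun_on (S :\ c)].
apply: (@leq_trans #|[set f : {ffun aT -> rT} | f @: setT == S]
                     :|: \bigcup_(c in S) miss c|).
  apply: subset_leq_card; apply/subsetP => f /ffun_onP fS.
  rewrite !inE eqEsubset.
  have -> /= : f @: setT \subset S by apply/subsetP => _ /imsetP[x _ ->].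
  case: (boolP (S \subset _)) => //= /subsetPn [c cS ncf].
  apply/bigcupP; exists c => //; rewrite inE; apply/ffun_onP => x.
  rewrite !inE fS andbT; apply: contraNneq ncf => <-; exact: imset_f.
apply: leq_trans (leq_card_setU _ _) _; rewrite leq_add2l.
apply: leq_trans (card_bigcup_leq _ _ _ _) _.
rewrite -sum_nat_const; apply: leq_sum => c cS.
rewrite cardsE card_ffun_on.
by have := cardsD1 c S; rewrite cS add1n => ->.
Qed.

(** That is, (t / (t+1))^m is at most t / m, which avoids any use of limits. *)
Lemma geometric_decay t m : m * t ^ m <= t * t.+1 ^ m.
Proof.
elim: m => [|m IH]; first by rewrite mul0n.
rewrite !expnS mulSn mulnCA [t.+1 * _]mulSn mulnDr leq_add //.
  rewrite leq_mul2l; case: (posnP m) => [-> | m0]; first by rewrite orbT.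
  by rewrite leq_exp2r // leqnSn orbT.
by rewrite leq_mul2l IH orbT.
Qed.

(** * Colorings with few colors *)

Lemma card_edge n : #|{: edge n}| = 'C(n, 2).
Proof.
by rewrite card_sig -[X in 'C(X, _)]card_ord -card_draws cardsE.
Qed.

Lemma card_edges_within n (A : {set 'I_n}) :
  #|[set e : edge n | val e \subset A]| = 'C(#|A|, 2).
Proof.
rewrite -cards_draws -(card_imset _ val_inj); apply: eq_card => B.
apply/imsetP/idP => [[e]|].
  by rewrite !inE => eA ->; rewrite eA (valP e).
rewrite inE => /andP[BA B2].
by exists (Sub B B2 : edge n); rewrite ?inE SubK.
Qed.

Lemma rainbow_free_few_colors r k n (phi : coloring r n) :
  #|phi @: setT| < 'C(k, 2) -> rainbow_free k phi.
Proof.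
move=> few; apply/forallP => A; apply/implyP => /eqP cardA.
have [||e [f [eA fA nef phief]]] :=
    @collision _ _ phi [set e : edge n | val e \subset A] (phi @: setT).
- exact/imsetS/subsetT.
- by rewrite card_edges_within cardA.
rewrite !inE in eA fA.
by apply/existsP; exists e; apply/existsP; exists f; rewrite nef eA fA phief /=.
Qed.

Lemma rho_few_colors r k n s : s < 'C(k, 2) ->
  'C(r, s) * s ^ 'C(n, 2) <=
    rho r k n + 'C(r, s) * (s * s.-1 ^ 'C(n, 2)).
Proof.
move=> lts; pose colors (phi : coloring r n) := phi @: setT.
have le_fib : \sum_(S : {set 'I_r} | #|S| == s)
    #|[set phi : coloring r n | colors phi == S]| <= rho r k n.
  apply: leq_trans (sum_card_fibers _ _ colors _ (fun S => #|S| == s)).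
  apply: leq_sum => S /eqP cardS; apply: subset_leq_card; apply/subsetP => phi.
  rewrite !inE => /[dup] phiS ->; rewrite andbT.
  by apply: rainbow_free_few_colors; rewrite -/(colors phi) (eqP phiS) cardS.
apply: leq_trans (leq_add le_fib (leqnn _)).
have -> : 'C(r, s) = #|[set S : {set 'I_r} | #|S| == s]|.
  by rewrite card_draws card_ord.
rewrite cardsE -!sum_nat_const -big_split /=; apply: leq_sum => S /eqP cardS.
by have := card_onto_lower_bound (edge n) _ S; rewrite cardS card_edge.
Qed.

(** * Colorings constant inside the Turan parts *)

Definition turan_edges p n : {set edge n} :=
  [set e : edge n | [exists x, exists y,
      (val e == [set x; y]) && turan_graph p x y]].

Lemma mem_turan_edges p n (e : edge n) (x y : 'I_n) : val e = [set x; y] ->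
  (e \in turan_edges p n) = (x %% p != y %% p).
Proof.
move=> exy; rewrite inE; apply/existsP/idP => [[u /existsP[v]]|nxy]; last first.
  by exists x; apply/existsP; exists y; rewrite exy eqxx.
rewrite /turan_graph exy => /andP[/eqP exyuv].
have: u \in [set x; y] by rewrite exyuv set21.
have: v \in [set x; y] by rewrite exyuv set22.
by rewrite !inE => /orP[]/eqP-> /orP[]/eqP-> //; rewrite ?eqxx // eq_sym.
Qed.

Lemma inside_edge n p (A : {set 'I_n}) : 0 < p -> p < #|A| ->
  exists x y, [/\ x \in A, y \in A, x != y &
    exists2 e : edge n, val e = [set x; y] & e \notin turan_edges p n].
Proof.
move=> p0 ltpA; pose res (x : 'I_n) := Ordinal (ltn_pmod x p0).
have [||x [y [xA yA nxy /(congr1 val)/= exy]]] := @collision _ _ res A setT.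
- exact: subsetT.
- by rewrite cardsT card_ord.
have xy2 : #|[set x; y]| == 2 by rewrite cards2 nxy.
exists x, y; split=> //; exists (Sub [set x; y] xy2); rewrite ?SubK //.
by rewrite (@mem_turan_edges _ _ _ x y) ?SubK // exy eqxx.
Qed.

(** After one inside edge x y of A is found, deleting x leaves more than k - 2
    vertices, hence a second inside edge, which avoids x. *)
Lemma rainbow_free_const_inside r k n (phi : coloring r n) (c : 'I_r) :
  3 <= k -> (forall e, e \notin turan_edges (k - 2) n -> phi e = c) ->
  rainbow_free k phi.
Proof.
move=> hk phic; have p0 : 0 < k - 2 by rewrite subn_gt0.
have ltp : k - 2 < k.-1 by rewrite -subn1 ltn_sub2l // (leq_trans _ hk).
apply/forallP => A; apply/implyP => /eqP cardA.
have [|x [y [xA yA nxy [e exy ein]]]] := @inside_edge n (k - 2) A p0.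
  by rewrite cardA (leq_trans ltp) // leq_pred.
have [|u [v [uA vA nuv [f fuv fin]]]] := @inside_edge n (k - 2) (A :\ x) p0.
  by move: ltp; have := cardsD1 x A; rewrite cardA xA => {2}->.
move: uA vA; rewrite !inE => /andP[nux uA] /andP[nvx vA].
apply/existsP; exists e; apply/existsP; exists f.
rewrite (phic e) // (phic f) // eqxx andbT exy fuv !subUset !sub1set.
rewrite xA yA uA vA !andbT.
apply/eqP => ef; have: x \in val f by rewrite -ef exy set21.
by rewrite fuv !inE ![x == _]eq_sym (negPf nux) (negPf nvx).
Qed.

Lemma rho_turan r k n : 3 <= k -> k - 1 <= n ->
  r ^ (1 + turan_number (k - 2) n) <= rho r k n.
Proof.
move=> hk hn; have p0 : 0 < k - 2 by rewrite subn_gt0.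
have [|x [y [_ _ _ [e0 _ e0in]]]] := @inside_edge n (k - 2) setT p0.
  by rewrite cardsT card_ord (leq_trans _ hn) // ltn_sub2l // (leq_trans _ hk).
(* The color of the inside edge e0 recovers the common inside color. *)
apply: leq_trans (sum_card_fibers _ _ (fun phi : coloring r n => phi e0) _ predT).
rewrite expnD expn1 -[X in X * _]card_ord -sum_nat_const; apply: leq_sum => c _.
rewrite -[X in X ^ _]card_ord.
rewrite -[X in _ ^ X]/#|turan_edges (k - 2) n| -(card_pffun_on c).
apply: subset_leq_card; apply/subsetP => phi /pffun_onP[/subsetP supp _].
have phic e : e \notin turan_edges (k - 2) n -> phi e = c.
  by move=> ein; apply: contraNeq ein => ne; apply: supp.
by rewrite !inE phic // eqxx andbT; apply: rainbow_free_const_inside phic.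
Qed.

Lemma rho_no_clique r k n : n < k -> rho r k n = r ^ 'C(n, 2).
Proof.
move=> ltnk; rewrite -card_edge -[X in X ^ _]card_ord -card_ffun -cardsT.
apply: eq_card => phi; rewrite !inE.
apply/forallP => A; apply/implyP => /eqP cardA.
by have := max_card A; rewrite card_ord cardA leqNgt ltnk.
Qed.

(** * The density of the Turan graph *)

Lemma card_smaller_congruent p y : 0 < p ->
  #|[set x : 'I_y | x %% p == y %% p]| = y %/ p.
Proof.
move=> p0; rewrite card_residue_class ?ltn_mod //.
have le : y %% p <= p.-1 by rewrite -ltnS prednK // ltn_mod.
rewrite {1}(divn_eq y p) -addnA subnKC // divnMDl //.
by rewrite (@divn_small p.-1) ?addn0 // prednK.
Qed.

Lemma inside_edges_bound p n : 0 < p ->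
  p * #|~: turan_edges p n| <= 'C(n, 2).
Proof.
move=> p0.
pose pairs := [set q : 'I_n * 'I_n | (q.2 %% p == q.1 %% p) && (q.2 < q.1)].
have le_pairs : #|~: turan_edges p n| <= #|pairs|.
  rewrite -(card_imset _ val_inj).
  apply: leq_trans (leq_imset_card (fun q : 'I_n * 'I_n => [set q.1; q.2]) pairs).
  apply: subset_leq_card; apply/subsetP => _ /imsetP[e + ->].
  have /cards2P [x [y [nxy exy]]] := valP e.
  rewrite inE (mem_turan_edges _ _ _ _ _ exy) negbK exy => cxy.
  apply/imsetP; case: (ltngtP x y) => [lt|lt|/val_inj eq].
  - by exists (y, x); rewrite ?inE /= ?lt ?cxy // setUC.
  - by exists (x, y); rewrite ?inE /= ?lt ?[y %% p == _]eq_sym ?cxy.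
  - by rewrite eq eqxx in nxy.
have card_pairs : #|pairs| = \sum_(y < n) y %/ p.
  transitivity (\sum_(y < n) \sum_(x < n | (x %% p == y %% p) && (x < y)) 1).
    rewrite pair_big_dep -sum1_card.
    by apply: eq_bigl => q; rewrite inE.
  apply: eq_bigr => y _; rewrite -card_smaller_congruent // -sum1_card.
  rewrite -(@big_ord_widen_cond _ _ _ _ _ (fun x => x %% p == y %% p)
    (fun=> 1) (ltnW (ltn_ord y))).
  by apply: eq_bigl => x; rewrite inE.
apply: leq_trans (leq_mul (leqnn p) le_pairs) _.
rewrite card_pairs big_distrr /= -bin2_sum big_mkord; apply: leq_sum => y _.
by rewrite mulnC leq_trunc_div.
Qed.

(** * Real exponents and limits *)

Local Open Scope ring_scope.

Lemma turan_density (R : realType) p n : (0 < p)%N ->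
  (1 - p%:R^-1) * 'C(n, 2)%:R <= (turan_number p n)%:R :> R.
Proof.
move=> p0; have pR : 0 < p%:R :> R by rewrite ltr0n.
have split_edges : ('C(n, 2) = turan_number p n + #|~: turan_edges p n|)%N.
  by rewrite -card_edge -(cardsC (turan_edges p n)).
have := inside_edges_bound p n p0.
rewrite -(ler_nat R) natrM -ler_pdivlMl // => le_inside.
rewrite mulrBl mul1r lerBlDr {1}split_edges natrD.
by rewrite lerD2l.
Qed.

Lemma leq_pred_bin2 n : (n.-1 <= 'C(n, 2))%N.
Proof. by case: n => // n; rewrite binS bin1 leq_addl. Qed.

Lemma few_colors_asymptotics (R : realType) (k r s : nat) (eps : R) :
  (s < 'C(k, 2))%N -> (0 < s)%N -> 0 < eps ->
  exists N : nat, forall n : nat, (N <= n)%N ->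
    ('C(r, s)%:R - eps) * s%:R ^+ 'C(n, 2) <= (rho r k n)%:R.
Proof.
case: s => // t lts _ eps0; set K := 'C(r, t.+1).
(* By geometric_decay, K s t^m <= eps s^m once m >= K s t / eps. *)
pose x : R := (K * t.+1 * t)%:R / eps.
have x0 : 0 <= x by rewrite divr_ge0 ?ler0n // ltW.
exists (Num.bound x).+2 => -[//|n]; rewrite ltnS => len.
have := rho_few_colors r k n.+1 _ lts; have := leq_pred_bin2 n.+1.
rewrite -/K; set m := 'C(_, 2) => /= len_m le_rho.
have m0 : (0 < m)%N by rewrite (leq_trans _ len_m) // (leq_trans _ len).
have xm : (K * t.+1 * t)%:R <= m%:R * eps.
  rewrite -ler_pdivrMr //; apply: le_trans (ltW (archi_boundP x0)) _.
  by rewrite ler_nat (leq_trans _ len_m) // ltnW.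
have small : (K * (t.+1 * t ^ m))%:R <= eps * t.+1%:R ^+ m.
  rewrite -(ler_pM2l (_ : 0 < m%:R :> R)) ?ltr0n //.
  apply: (@le_trans _ _ ((K * t.+1 * t)%:R * t.+1%:R ^+ m)); last first.
    by rewrite mulrA ler_wpM2r ?exprn_ge0 ?ler0n.
  rewrite -natrX -!natrM ler_nat -!mulnA mulnCA (mulnCA m).
  by rewrite !leq_mul2l geometric_decay !orbT.
rewrite mulrBl lerBlDr; apply: le_trans (lerD (lexx _) small).
by rewrite -natrX -natrM -natrD ler_nat.
Qed.

Theorem mainTheorem3 (R : realType) (k : nat) (hk : (3 <= k)%N) :
  let s := ('C(k, 2) - 1)%N in
  (forall (r : nat) (eps : R), (s <= r)%N -> 0 < eps ->
     exists N : nat, forall n : nat, (N <= n)%N ->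
       ('C(r, s)%:R - eps) * s%:R ^+ 'C(n, 2) <= (rho r k n)%:R)
  /\
  (forall r n : nat, (1 <= r)%N -> (3 <= n)%N ->
     [/\ (k - 1 <= n)%N -> (r ^ (1 + turan_number (k - 2) n) <= rho r k n)%N,
         (r%:R : R) `^ ((1 - (k - 2)%:R^-1) * 'C(n, 2)%:R)
           <= (r ^ (1 + turan_number (k - 2) n))%:R
       & (r%:R : R) `^ ((1 - (k - 2)%:R^-1) * 'C(n, 2)%:R)
           <= (rho r k n)%:R]).
Proof.
move=> s; have p0 : (0 < k - 2)%N by rewrite subn_gt0.
have bin_gt1 : (1 < 'C(k, 2))%N by rewrite (leq_trans _ (leq_pred_bin2 k)) // ltn_predRL.
split=> [r eps _ eps0 | r n r1 _].
  apply: few_colors_asymptotics => //; last by rewrite subn_gt0.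
  by rewrite /s subn1 prednK // ltnW.
have rR : 1 <= r%:R :> R by rewrite ler1n.
have le_pow (a : R) m : a <= m%:R -> (r%:R : R) `^ a <= (r ^ m)%:R.
  move=> am; rewrite natrX -powR_mulrn ?ler0n //.
  exact: ler_powR.
have le_turan : (r%:R : R) `^ ((1 - (k - 2)%:R^-1) * 'C(n, 2)%:R)
    <= (r ^ (1 + turan_number (k - 2) n))%:R.
  apply: le_pow; apply: le_trans (turan_density R _ n p0) _.
  by rewrite ler_nat leq_addl.
split=> //; first exact: rho_turan.
have [large | small] := leqP (k - 1) n.
  by apply: le_trans le_turan _; rewrite ler_nat rho_turan.
rewrite rho_no_clique; last by rewrite (leq_trans small) // leq_subr.
apply: le_pow; rewrite ler_piMl ?ler0n // lerBlDr lerDl.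
by rewrite invr_ge0 ler0n.
Qed.
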